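(* Let $C$ be the Cantor function on $[0,1]$, i.e. the distribution function $C(x)=c[0,x)$ of the Cantor measure $c$. Then for every $0<x<1$, $$C(x)=\frac{1}{2}+\frac{1}{\pi}\sum_{n=1}^\infty \frac{(-1)^n\prod_{k=1}^\infty \cos\left(\frac{2n\pi}{3^k}\right)-1}{n}\,\sin(2\pi nx).$$
   Context: The Cantor measure $c$ is the standard Cantor probability measure on the middle-thirds Cantor set, regarded as a Borel probability measure on the unit circle $\mathbb{T}$ identified with $[0,1)$. The infinite series $\sum_{n=1}^\infty$ is the limit of the partial sums $\sum_{n=1}^N$ as $N\to\infty$. *)

(* Defs.v *)
From HB Require Import structures.
From mathcomp Require Import all_boot all_order all_algebra.
From mathcomp Require Import all_classical all_reals all_analysis.
From mathcomp Require Import measurable_realfun ring lra.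
Set Implicit Arguments.
Unset Strict Implicit.
Unset Printing Implicit Defensive.
Import Order.TTheory GRing.Theory Num.Theory.
Import numFieldNormedType.Exports.
Local Open Scope classical_set_scope.
Local Open Scope ring_scope.

(* The closed interval obtained from [a, b] by repeatedly removing the open
   middle third and keeping the left ([false]) or the right ([true]) third.
   The intervals [middle_third_itv 0 1 w] with [size w = n] are the 2 ^ n
   components of the n-th stage of the construction of the Cantor set. *)
Fixpoint middle_third_itv (R : realType) (a b : R) (w : seq bool) : set R :=
  match w with
  | [::] => `[a, b]
  | false :: w' => middle_third_itv a (a + (b - a) / 3) w'
  | true :: w' => middle_third_itv (b - (b - a) / 3) b w'
  end.

(* The Cantor measure: the Borel probability measure that gives the same mass
   to all components of each stage of the construction of the Cantor set. It is
   thereby carried by the Cantor set and atomless, so it lives on [0, 1), which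
   represents the circle. *)
Definition is_cantor_measure (R : realType)
    (c : probability (measurableTypeR R) R) : Prop :=
  forall w : seq bool, c (middle_third_itv 0 1 w) = ((1 / 2) ^+ size w)%:E.

(* Existence: push the uniform distribution on [0, 1] forward along
   sum_k b_k / 2 ^ k |-> sum_k 2 b_k / 3 ^ k. *)
Fixpoint ternary_approx (R : realType) (n : nat) (u : R) : R :=
  if n is n'.+1 then
    if u < 1 / 2 then ternary_approx n' (2 * u) / 3
    else 2 / 3 + ternary_approx n' (2 * u - 1) / 3
  else 0.

Lemma ternary_approxS (R : realType) n (u : R) : ternary_approx n.+1 u =
  if u < 1 / 2 then ternary_approx n (2 * u) / 3
  else 2 / 3 + ternary_approx n (2 * u - 1) / 3.
Proof. by []. Qed.

Lemma ternary_approx_itv (R : realType) n (u : R) : 0 <= ternary_approx n u <= 1.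
Proof.
elim: n u => [|n IH] u /=; first by rewrite lexx ler01.
by case: ifP => _; [have := IH (2 * u) | have := IH (2 * u - 1)]; lra.
Qed.

Lemma nondecreasing_ternary_approx (R : realType) (u : R) :
  nondecreasing_seq (fun n => ternary_approx n u).
Proof.
apply/nondecreasing_seqP => n; elim: n u => [|n IH] u.
  by have /andP[] := ternary_approx_itv 1 u.
rewrite (ternary_approxS n u) (ternary_approxS n.+1 u); case: ifP => _.
  by have := IH (2 * u); lra.
by have := IH (2 * u - 1); lra.
Qed.

Lemma cvg_ternary_approx (R : realType) (u : R) : cvgn (fun n => ternary_approx n u).
Proof.
apply: nondecreasing_is_cvgn; first exact: nondecreasing_ternary_approx.
by exists 1 => _ [n _ <-]; have /andP[] := ternary_approx_itv n u.
Qed.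

Definition ternary_lim (R : realType) (u : R) : R := limn (fun n => ternary_approx n u).

Lemma ternary_limE (R : realType) (u : R) : ternary_lim u =
  if u < 1 / 2 then ternary_lim (2 * u) / 3
  else 2 / 3 + ternary_lim (2 * u - 1) / 3.
Proof.
apply/cvg_lim => //; rewrite -cvg_shiftS /=.
case: ifP => _; [|apply: cvgD; first exact: cvg_cst]; apply: cvgMr_tmp;
  exact: cvg_ternary_approx.
Qed.

Lemma ternary_lim_itv (R : realType) (u : R) : 0 <= ternary_lim u <= 1.
Proof.
apply/andP; split.
  apply: limr_ge; first exact: cvg_ternary_approx.
  by apply: nearW => n; have /andP[] := ternary_approx_itv n u.
apply: limr_le; first exact: cvg_ternary_approx.
by apply: nearW => n; have /andP[] := ternary_approx_itv n u.
Qed.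

Lemma measurable_ternary_approx (R : realType) n :
  measurable_fun setT (@ternary_approx R n : measurableTypeR R -> R).
Proof.
elim: n => [|n IH] /=; first exact: measurable_cst.
have m2 : measurable_fun [set: measurableTypeR R] (fun t : R => 2 * t).
  exact: mulrl_measurable.
have m21 : measurable_fun [set: measurableTypeR R] (fun t : R => 2 * t - 1).
  by apply: (measurable_funB m2); exact: measurable_cst.
have M (f : measurableTypeR R -> R) : measurable_fun setT f ->
    measurable_fun setT (fun t => f t / 3).
  by move=> mf; apply: (measurable_funM mf); exact: measurable_cst.
apply: measurable_fun_ifT => /=.
- by apply: measurable_fun_ltr; [exact: measurable_id|exact: measurable_cst].
- exact: (M _ (measurableT_comp IH m2)).
- exact: (measurable_funD (@measurable_cst _ _ _ _ _ (2 / 3 : R))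
    (M _ (measurableT_comp IH m21))).
Qed.

(* The value - 1 keeps points outside [0, 1) away from the Cantor set. *)
Definition ternary_map (R : realType) (u : measurableTypeR R) : measurableTypeR R :=
  if 0 <= u < 1 then ternary_lim u else - 1.

Lemma measurable_ternary_map (R : realType) : measurable_fun setT (@ternary_map R).
Proof.
apply: measurable_fun_ifT => //=.
  by apply: measurable_and; [exact: measurable_fun_ler|exact: measurable_fun_ltr].
apply: (measurable_fun_cvg (h := @ternary_approx R)).
  by move=> n; exact: measurable_ternary_approx.
by move=> u _; exact: cvg_ternary_approx.
Qed.

HB.instance Definition _ (R : realType) :=
  isMeasurableFun.Build _ _ _ _ (@ternary_map R) (@measurable_ternary_map R).

Lemma middle_third_itv_sub (R : realType) (a b : R) w : a <= b ->
  middle_third_itv a b w `<=` `[a, b].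
Proof.
elim: w a b => [|[] w IH] a b ab //= u wu.
  have := IH (b - (b - a) / 3) b _ u wu.
  by rewrite /= !in_itv /= => H; have := H ltac:(lra); lra.
have := IH a (a + (b - a) / 3) _ u wu.
by rewrite /= !in_itv /= => H; have := H ltac:(lra); lra.
Qed.

Lemma middle_third_itv_ternary (R : realType) w (a b : R) : a < b ->
  exists y, [/\ 0 <= y, y + (1 / 2) ^+ size w <= 1 & forall u, 0 <= u < 1 ->
    middle_third_itv a b w (a + (b - a) * ternary_lim u) <->
    y <= u < y + (1 / 2) ^+ size w].
Proof.
elim: w a b => [|d w IH] a b ab /=.
  exists 0; rewrite expr0; split; rewrite ?add0r // => u u01.
  rewrite /= in_itv /=; split => // _.
  by have := ternary_lim_itv u; nra.
have s0 : 0 < (1 / 2 : R) ^+ size w by apply: exprn_gt0; lra.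
rewrite exprS; set s := _ ^+ size w in IH s0 *.
case: d.
  have [|y [y0 y1 H]] := IH (b - (b - a) / 3) b; first by lra.
  exists ((1 + y) / 2); split; [lra|lra|] => u u01.
  rewrite ternary_limE; case: ifPn => u2.
    split; last by lra.
    move=> /middle_third_itv_sub; rewrite /= in_itv /=.
    by have := ternary_lim_itv (2 * u); move=> ? h; have := h ltac:(lra); nra.
  rewrite (_ : a + _ = b - (b - a) / 3
      + (b - (b - (b - a) / 3)) * ternary_lim (2 * u - 1)); last by field.
  by have -> := H (2 * u - 1) ltac:(lra); split; lra.
have [|y [y0 y1 H]] := IH a (a + (b - a) / 3); first by lra.
exists (y / 2); split; [lra|lra|] => u u01.
rewrite ternary_limE; case: ifPn => u2; last first.
  split; last by lra.
  move=> /middle_third_itv_sub; rewrite /= in_itv /=.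
  by have := ternary_lim_itv (2 * u - 1); move=> ? h; have := h ltac:(lra); nra.
rewrite (_ : a + (b - a) * (_ / 3) =
  a + (a + (b - a) / 3 - a) * ternary_lim (2 * u)); last by field.
by have -> := H (2 * u) ltac:(lra); split; lra.
Qed.

Lemma cantor_measure_exists (R : realType) :
  exists c : probability (measurableTypeR R) R, is_cantor_measure c.
Proof.
pose X : {mfun measurableTypeR R >-> measurableTypeR R} := @ternary_map R.
exists (distribution (uniform_prob (@ltr01 R)) X) => w.
have [y [y0 y1 H]] := middle_third_itv_ternary w (@ltr01 R).
have s0 : 0 < (1 / 2 : R) ^+ size w by apply: exprn_gt0; lra.
change (uniform_prob (@ltr01 R) (@ternary_map R @^-1` middle_third_itv 0 1 w) =
  ((1 / 2) ^+ size w)%:E).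
rewrite (_ : @ternary_map R @^-1` _ = `[y, y + (1 / 2) ^+ size w[%classic); last first.
  apply/seteqP; split => u /=; rewrite /ternary_map in_itv /=.
    case: ifPn => u01.
      by have := H u u01; rewrite subr0 add0r [1 * ternary_lim u]mul1r => -[h1 h2]; exact: h1.
    by move=> /middle_third_itv_sub; rewrite /= in_itv /= => h; have := h ltac:(lra); lra.
  move=> yu; have u01 : 0 <= u < 1 by lra.
  by rewrite u01; have := H u u01; rewrite subr0 add0r [1 * ternary_lim u]mul1r => -[h1 h2]; exact: h2.
rewrite /uniform_prob (eq_integral (fun=> 1%E)); last first.
  move=> u; rewrite inE /= in_itv /= /uniform_pdf => yu.
  by rewrite ifT ?subr0 ?invr1//; lra.
rewrite integral_cst //= mul1e lebesgue_measure_itv /= lte_fin ifT; last by lra.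
by rewrite -EFinD; congr EFin; lra.
Qed.

Definition distribution_function (R : realType)
    (c : probability (measurableTypeR R) R) (x : R) : R :=
  fine (c `[0, x[%classic).

Definition cos_partial_prod (R : realType) (n K : nat) : R :=
  \prod_(1 <= k < K.+1) cos (2 * n%:R * pi / 3 ^+ k).

Definition cos_infinite_prod (R : realType) (n : nat) : R :=
  limn (@cos_partial_prod R n).

Definition sine_partial_sum (R : realType) (x : R) (N : nat) : R :=
  \sum_(1 <= n < N.+1)
    ((-1) ^+ n * cos_infinite_prod R n - 1) / n%:R * sin (2 * pi * n%:R * x).

(* Main.v *)
Require Import Defs.
From HB Require Import structures.
From mathcomp Require Import all_boot all_order all_algebra.
From mathcomp Require Import all_classical all_reals all_analysis.
From mathcomp Require Import measurable_realfun ring lra zify.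
Set Implicit Arguments.
Unset Strict Implicit.
Unset Printing Implicit Defensive.
Import Order.TTheory GRing.Theory Num.Theory.
Import numFieldNormedType.Exports.
Local Open Scope classical_set_scope.
Local Open Scope ring_scope.

(** For [0 < t < pi] the partial sums of [\sum_n sin (2 n t) / n] tend to
    [pi / 2 - t], and they are bounded uniformly in [N] and [t]
    ([sawtooth_sum_cvg], [sawtooth_sum_bounded]). Call the limit, extended to an
    odd function of period [pi], the sawtooth [S]. For [t] in [[0, 1]] other than
    [x], it satisfies
      [S (pi (x - t)) = pi (1_{t < x} + t - x - 1 / 2)].
    The Cantor measure has no atoms and its mean is [1 / 2], so by bounded
    convergence the integrals of the partial sums at [pi (x - t)] tend to
    [pi (C x - x)] ([cantor_sawtooth_cvg]). Subtracting the partial sums at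
    [pi x], whose limit is [pi / 2 - pi x], leaves [pi (C x - 1 / 2)].

    Before the limit, this difference is a partial sum of the series of the
    theorem, by the Fourier coefficients of the Cantor measure
    ([sine_partial_sumE], [cantor_fourier]). These come from averaging a function over the midpoints
    of the [2 ^ n] intervals of stage [n]: for a Lipschitz function the averages
    converge to the integral ([midpoint_avg_cvg]), and for a sine wave the
    identity [sin (m + d) + sin (m - d) = 2 sin m cos d] contributes
    one more cosine factor at each stage ([midpoint_avg_sin]). The convergence of the
    cosine products falls out of the same computation. *)

(** * Partial sums of the sawtooth series *)

Lemma norm_sin_natmul (R : realType) (n : nat) (t : R) :
  `|sin (n%:R * t)| <= n%:R * `|sin t|.
Proof.
elim: n => [|n IH]; first by rewrite !mul0r sin0 normr0.
rewrite -natr1 !mulrDl !mul1r sinD.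
apply: le_trans (ler_normD _ _) _; rewrite !normrM lerD //.
  by apply: le_trans IH; rewrite ler_piMr // cos_max.
by rewrite ler_piMl // cos_max.
Qed.

(** With the argument doubled, the closed form of the derivative has
    denominator [sin t] instead of [sin (t / 2)]. *)
Definition sawtooth_sum (R : realType) (N : nat) (t : R) : R :=
  \sum_(1 <= n < N.+1) sin (2 * n%:R * t) / n%:R.

Lemma sawtooth_sumS (R : realType) (N : nat) (t : R) :
  sawtooth_sum N.+1 t = sawtooth_sum N t + sin (2 * N.+1%:R * t) / N.+1%:R.
Proof. by rewrite /sawtooth_sum big_nat_recr. Qed.

Lemma sawtooth_sumN (R : realType) (N : nat) (t : R) :
  sawtooth_sum N (- t) = - sawtooth_sum N t.
Proof.
by rewrite /sawtooth_sum -sumrN; apply: eq_bigr => n _; rewrite mulrN sinN mulNr.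
Qed.

Lemma sin_natmulBpi (R : realType) (n : nat) (t : R) :
  sin (2 * n%:R * (t - pi)) = sin (2 * n%:R * t).
Proof.
rewrite -(periodicn (@sinD2pi R) n); congr sin.
by rewrite -[pi *+ 2]mulr_natl -[_ *+ n]mulr_natl; ring.
Qed.

Lemma sawtooth_sumBpi (R : realType) (N : nat) (t : R) :
  sawtooth_sum N (t - pi) = sawtooth_sum N t.
Proof. by apply: eq_bigr => n _; rewrite sin_natmulBpi. Qed.

(** The sum of [e ^ (2 i n t)] over [- N <= n <= N]. *)
Definition dirichlet_kernel (R : realType) (N : nat) (t : R) : R :=
  1 + \sum_(1 <= n < N.+1) 2 * cos (2 * n%:R * t).

Lemma dirichlet_kernelE (R : realType) (N : nat) (t : R) :
  sin t * dirichlet_kernel N t = sin (N.*2.+1%:R * t).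
Proof.
rewrite /dirichlet_kernel; elim: N => [|N IH].
  by rewrite big_nil addr0 mulr1 mul1r.
rewrite big_nat_recr //= addrA mulrDr IH doubleS.
rewrite -[N.*2.+3%:R]natr1 -[N.*2.+2%:R]natr1.
rewrite (_ : 2 * N.+1%:R = N.*2.+1%:R + 1 :> R); last first.
  by rewrite natr1 -natrM mul2n doubleS.
rewrite !mulrDl !mul1r !sinD !cosD.
set s := sin t; set c := cos t; set S := sin _; set C := cos _.
(* The two sides differ by [S * (1 - c ^+ 2 - s ^+ 2)]. *)
have S1 : S = S * (c ^+ 2 + s ^+ 2) by rewrite cos2Dsin2 mulr1.
by rewrite {1}S1; ring.
Qed.

Lemma is_derive_sawtooth_sum (R : realType) (N : nat) (t : R) :
  is_derive t 1 (sawtooth_sum N) (dirichlet_kernel N t - 1).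
Proof.
rewrite /dirichlet_kernel addrC addKr.
elim: N => [|N IH].
  rewrite (_ : sawtooth_sum 0%N = cst 0) ?big_nil; first exact: is_derive_cst.
  by apply/funext => u; rewrite /sawtooth_sum big_nil.
rewrite big_nat_recr //= (_ : sawtooth_sum N.+1 =
  sawtooth_sum N + (fun u => N.+1%:R^-1 *: sin (2 * N.+1%:R * u))); last first.
  by apply/funext => u; rewrite sawtooth_sumS mulrC.
apply: is_deriveD.
by apply: is_derive_eq; rewrite /GRing.scale /=; field.
Qed.

Lemma sin_natmul_pi (R : realType) (n : nat) : sin (n%:R * pi) = 0 :> R.
Proof.
by apply/normr0_eq0/le_anti; rewrite normr_ge0 andbT;
  apply: le_trans (norm_sin_natmul _ _) _; rewrite sinpi normr0 mulr0.
Qed.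

Lemma sawtooth_sum_pihalf (R : realType) (N : nat) :
  sawtooth_sum N (pi / 2) = 0 :> R.
Proof.
apply: big1 => n _; rewrite (_ : _ * (pi / 2) = n%:R * pi); last by field.
by rewrite sin_natmul_pi mul0r.
Qed.

(** Let [M = 2 N + 1], let [h t = 1 / (M sin t)] and let [E] be the error
    [sawtooth_sum N t - (pi / 2 - t)], so that [E' = sin (M t) / sin t]. One
    integration by parts suggests to look at [E + cos (M t) h], whose derivative
    is [cos (M t) h'] and is therefore dominated by [- h'] where [h] decreases.
    Hence [h + e (E + cos (M t) h)] decreases on [(0, pi / 2]], and at [pi / 2] it
    equals [h], because [E] and [cos (M t)] vanish there. *)
Lemma sawtooth_error_barrier (R : realType) (N : nat) (e t : R) :
  -1 <= e <= 1 -> 0 < t <= pi / 2 ->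
  0 <= N.*2.+1%:R^-1 * (sin t)^-1 + e * (sawtooth_sum N t - (pi / 2 - t) +
    cos (N.*2.+1%:R * t) * (N.*2.+1%:R^-1 * (sin t)^-1)).
Proof.
set M : R := N.*2.+1%:R; move=> e1 t0; have M0 : 0 < M by rewrite ltr0n.
pose h (u : R) := M^-1 * (sin u)^-1.
pose U (u : R) := h u + e * ((sawtooth_sum N u - (pi / 2 - u)) + cos (M * u) * h u).
have sin0 u : t <= u <= pi / 2 -> 0 < sin u.
  by move=> ut; apply: sin_gt0_pi; have := @pi_ge2 R; lra.
pose dh (u : R) := - (M^-1 * cos u / sin u ^+ 2).
have Dh u : t <= u <= pi / 2 -> is_derive u 1 h (dh u).
  move=> ut; have s0 : sin u != 0 by rewrite gt_eqF // sin0.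
  rewrite /h /dh.
  have := is_deriveV s0 (is_derive_sin u) => dV.
  by apply: is_derive_eq; rewrite /GRing.scale /=; field; rewrite ?s0 ?gt_eqF.
have DU u : t <= u <= pi / 2 -> is_derive u 1 U (dh u * (1 + e * cos (M * u))).
  move=> ut; have s0 : sin u != 0 by rewrite gt_eqF // sin0.
  have dh' := Dh _ ut; have dS := is_derive_sawtooth_sum N u.
  rewrite /U; apply: is_derive_eq; rewrite /GRing.scale /=.
  have DK : dirichlet_kernel N u = sin (M * u) / sin u.
    by rewrite -dirichlet_kernelE mulrC mulKf.
  rewrite DK /h. field; rewrite s0 gt_eqF //.
have Uc : {within `[t, pi / 2], continuous U}.
  apply: derivable_within_continuous => u; rewrite in_itv /= => ut.
  by have [] := DU u ut.
have U_decr : U (pi / 2) <= U t.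
  apply: (ler0_derive1_nincr (a := t) (b := pi / 2)) => //; last by lra.
    by move=> u; rewrite in_itv /= => ut; have [] := DU u ltac:(lra).
  move=> u; rewrite in_itv /= => ut; have du := DU u ltac:(lra).
  rewrite derive1E derive_val; apply: mulr_le0_ge0.
    rewrite /dh oppr_le0; apply: mulr_ge0; last by rewrite invr_ge0 sqr_ge0.
    apply: mulr_ge0; first by rewrite invr_ge0 ltW.
    by apply: cos_ge0_pihalf; lra.
  by have := cos_geN1 (M * u); have := cos_le1 (M * u); nra.
apply: le_trans U_decr; rewrite /U /h sawtooth_sum_pihalf sin_pihalf invr1.
have -> : cos (M * (pi / 2)) = 0.
  rewrite /M -natr1 -mul2n natrM.
  rewrite (_ : _ * (pi / 2) = N%:R * pi + pi / 2); last by field.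
  by rewrite cosDpihalf sin_natmul_pi oppr0.
by rewrite subrr mul0r subr0 addr0 mulr0 addr0 mulr1 invr_ge0 ltW.
Qed.

(** The barrier with [e = 1] and [e = - 1] gives [|E + cos (M t) h| <= h], hence
    [|E| <= 2 h]; the reflection [t |-> pi - t] takes care of the second half of
    the interval. *)
Lemma sawtooth_sum_error (R : realType) (N : nat) (t : R) : 0 < t < pi ->
  `|sawtooth_sum N t - (pi / 2 - t)| <= 2 * (N.*2.+1%:R^-1 * (sin t)^-1).
Proof.
wlog t2 : t / t <= pi / 2.
  move=> H t0; have [|t2] := leP t (pi / 2); first by move=> ?; exact: H.
  have := H (pi - t) ltac:(lra) ltac:(lra).
  rewrite -[pi - t]opprB sawtooth_sumN sawtooth_sumBpi sinN -sinDpi subrK -normrN.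
  by congr (`|_| <= _); lra.
move=> t0; have /andP[t0' _] := t0.
have s0 : 0 < sin t by exact: sin_gt0_pi.
have h0 : 0 <= N.*2.+1%:R^-1 * (sin t)^-1 by rewrite mulr_ge0 // invr_ge0 // ltW.
have := @sawtooth_error_barrier R N 1 t ltac:(lra) ltac:(lra).
have := @sawtooth_error_barrier R N (-1) t ltac:(lra) ltac:(lra).
set E := _ - _; set h := _ / _ in h0 *; set c := cos _ => H1 H2.
have c1 : -1 <= c <= 1 by rewrite cos_geN1 cos_le1.
by rewrite ler_norml; nra.
Qed.

Lemma sawtooth_sum_cvg (R : realType) (t : R) : 0 < t < pi ->
  sawtooth_sum N t @[N --> \oo] --> pi / 2 - t.
Proof.
move=> t0; apply/cvgrPdist_le => e e0.
have s0 : 0 < sin t by exact: sin_gt0_pi.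
near=> N; rewrite distrC; apply: le_trans (sawtooth_sum_error N t0) _.
rewrite mulrCA ler_pdivrMl ?ltr0n // ler_pdivrMr // .
have : 2 / (e * sin t) <= N%:R by near: N; exact: nbhs_infty_ger.
rewrite ler_pdivrMr; last by rewrite mulr_gt0.
have : N%:R <= N.*2.+1%:R :> R by rewrite ler_nat; lia.
by have := mulr_gt0 e0 s0; nra.
Unshelve. all: by end_near. Qed.

(** Where [(2 N + 1) sin t >= 1] the error estimate gives the bound. Elsewhere
    each term is small, because [|sin (2 n t)| <= 2 n |sin t|], and the [N] terms
    add up to at most [2 N sin t <= 1]. *)
Lemma sawtooth_sum_bounded (R : realType) (N : nat) (t : R) : - pi <= t <= pi ->
  `|sawtooth_sum N t| <= 2 + pi.
Proof.
have pi0 := @pi_ge2 R.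
wlog t0 : t / 0 <= t.
  move=> H; have [|t0] := leP 0 t; first exact: H.
  by move=> tpi; have := H (- t) ltac:(lra) ltac:(lra); rewrite sawtooth_sumN normrN.
move=> tpi.
have Mle : N%:R <= N.*2.+1%:R :> R by rewrite ler_nat; lia.
have M0 : 0 < N.*2.+1%:R :> R by rewrite ltr0n.
have small : N.*2.+1%:R * sin t <= 1 -> `|sawtooth_sum N t| <= 2 + pi.
  move=> sM; have s0 : 0 <= sin t by apply: sin_ge0_pi; lra.
  have : `|sawtooth_sum N t| <= \sum_(1 <= n < N.+1) 2 * sin t.
    apply: le_trans (ler_norm_sum _ _ _) _.
    rewrite big_nat [leRHS]big_nat; apply: ler_sum => n /andP[n0 _].
    rewrite normrM normfV [`|n%:R|]ger0_norm // ler_pdivrMr ?ltr0n // -natrM.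
    by apply: le_trans (norm_sin_natmul _ _) _; rewrite natrM ger0_norm // mulrAC.
  rewrite sumr_const_nat subSS subn0 -mulr_natl => H; apply: le_trans H _.
  by nra.
have [//|sM] := leP (N.*2.+1%:R * sin t) 1.
have s0 : 0 < sin t by nra.
have t0pi : 0 < t < pi.
  rewrite !lt_neqAle t0 eq_sym; case/andP: tpi => _ ->; rewrite !andbT.
  by apply/andP; split; apply/eqP => E; move: s0; rewrite E ?sin0 ?sinpi ltxx.
have h1 : N.*2.+1%:R^-1 * (sin t)^-1 <= 1.
  by rewrite -invfM invf_le1 ?mulr_gt0 // ltW.
have := sawtooth_sum_error N t0pi; move: h1; set h := _ * _ => h1.
by rewrite !ler_norml; lra.
Qed.

(** * The Cantor measure on one interval of the construction *)

Lemma bounded_integrable (d : measure_display) (T : measurableType d)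
    (R : realType) (mu : probability T R) (D : set T) (f : T -> R) (B : R) :
  measurable D -> measurable_fun [set: T] f -> (forall t, D t -> `|f t| <= B) ->
  mu.-integrable D (EFin \o f).
Proof.
move=> mD mf fB; apply: measurable_bounded_integrable => //.
- by rewrite -ge0_fin_numE // fin_num_measure.
- exact: measurable_funTS.
- exists B; split; first exact: num_real.
  by move=> M BM t Dt; apply: le_trans (fB t Dt) (ltW BM).
Qed.

(** The part of the measure on [[a, b]] is a scaled copy of the Cantor measure,
    of mass [s]. Unlike the property of the whole measure, this one passes to the
    two outer thirds, which makes induction on the stages possible. *)
Definition cantor_on (R : realType) (c : probability (measurableTypeR R) R)
    (a b s : R) : Prop :=
  forall w : seq bool, c (middle_third_itv a b w) = (s * (1 / 2) ^+ size w)%:E.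

Section cantor_on.
Variables (R : realType) (c : probability (measurableTypeR R) R).
Implicit Types a b s : R.

Lemma cantor_onW a b s : cantor_on c a b s -> c `[a, b]%classic = s%:E.
Proof. by move=> /(_ [::]) /= ->; rewrite expr0 mulr1. Qed.

Lemma cantor_on_left a b s : cantor_on c a b s ->
  cantor_on c a (a + (b - a) / 3) (s / 2).
Proof.
by move=> H w; have /= -> := H (false :: w); rewrite exprS mulrA mul1r.
Qed.

Lemma cantor_on_right a b s : cantor_on c a b s ->
  cantor_on c (b - (b - a) / 3) b (s / 2).
Proof.
by move=> H w; have /= -> := H (true :: w); rewrite exprS mulrA mul1r.
Qed.

Lemma cantor_on_ge0 a b s : cantor_on c a b s -> 0 <= s.
Proof. by move=> /cantor_onW; rewrite -lee_fin => <-. Qed.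

(** The two outer thirds already carry all of the mass. *)
Lemma cantor_on_gap a b s : a < b -> cantor_on c a b s ->
  c `]a + (b - a) / 3, b - (b - a) / 3[%classic = 0%E.
Proof.
move=> ab H; set a' := a + _; set b' := b - _.
have -> : `]a', b'[%classic = `[a, b]%classic `\` (`[a, a'] `|` `[b', b])%classic
    :> set (measurableTypeR R).
  rewrite /a' /b'; apply/seteqP; split => u /=; rewrite !in_itv /=.
    by move=> ut; split; [lra|case; lra].
  move=> [ut nu]; apply/andP; split; rewrite ltNge; apply/negP => ?; apply: nu.
    by left; lra.
  by right; lra.
rewrite measureD //=; last 2 first.
  by apply: measurableU.
  by rewrite -ge0_fin_numE // fin_num_measure.
rewrite setIidr; last first.
  by rewrite /a' /b' => u /= [] /=; rewrite !in_itv /=; lra.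
rewrite measureU //=; last first.
  rewrite /a' /b'; apply/seteqP; split => u //= [] /=; rewrite !in_itv /=.
  by move=> ??; exfalso; lra.
rewrite (cantor_onW H) (cantor_onW (cantor_on_left H)).
rewrite (cantor_onW (cantor_on_right H)).
by rewrite -!EFinD; congr EFin; lra.
Qed.

(** At each stage a point lies in an outer third, of half the mass, or in the
    middle third, which is null. *)
Lemma cantor_on_set1_le a b s x n : a < b -> x \in `[a, b] -> cantor_on c a b s ->
  (c [set x] <= (s * (1 / 2) ^+ n)%:E)%E.
Proof.
elim: n a b s => [|n IH] a b s ab xab H.
  rewrite expr0 mulr1 -(cantor_onW H); apply: le_measure; rewrite ?inE //=.
  by move=> _ ->.
move: xab; rewrite in_itv /= => xab.
rewrite (_ : s * _ = s / 2 * (1 / 2) ^+ n); last by rewrite exprS; field.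
have [xl|xl] := leP x (a + (b - a) / 3).
  apply: (IH _ _ _ _ _ (cantor_on_left H)); first by lra.
  by rewrite in_itv /=; lra.
have [xr|xr] := leP (b - (b - a) / 3) x.
  apply: (IH _ _ _ _ _ (cantor_on_right H)); first by lra.
  by rewrite in_itv /=; lra.
apply: (@le_trans _ _ (c `]a + (b - a) / 3, b - (b - a) / 3[%classic)).
  apply: le_measure; rewrite ?inE //= => _ ->.
  by rewrite /= in_itv /=; lra.
rewrite (cantor_on_gap ab H) lee_fin mulr_ge0 ?exprn_ge0 //.
by rewrite divr_ge0 // (cantor_on_ge0 H).
Qed.

Lemma cantor_on_set1 a b s x : a < b -> x \in `[a, b] -> cantor_on c a b s ->
  c [set x] = 0%E.
Proof.
move=> ab xab H; apply/le_anti; rewrite measure_ge0 andbT.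
have cf : c [set x] \is a fin_num by exact: fin_num_measure.
rewrite -(fineK cf) lee_fin.
have : s * (1 / 2) ^+ n @[n --> \oo] --> (0 : R).
  rewrite -(mulr0 s); apply: cvgMl_tmp; apply: cvg_expr.
  by rewrite ger0_norm; lra.
move=> cv0; have <- := cvg_lim (@Rhausdorff R) cv0.
apply: limr_ge; first exact: (cvgP _ cv0).
by apply: nearW => n; rewrite -lee_fin fineK //; exact: cantor_on_set1_le H.
Qed.
End cantor_on.

(** * Integrals against the Cantor measure as limits of midpoint averages *)

Fixpoint midpoint_avg (R : realType) (f : R -> R) (n : nat) (a b : R) : R :=
  if n is n'.+1 then
    (midpoint_avg f n' a (a + (b - a) / 3) +
     midpoint_avg f n' (b - (b - a) / 3) b) / 2
  else f ((a + b) / 2).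

Lemma midpoint_avg_id (R : realType) (n : nat) (a b : R) :
  midpoint_avg id n a b = (a + b) / 2.
Proof. by elim: n a b => [//|n IH] a b /=; rewrite !IH; field. Qed.

(** The two outer thirds have their midpoints at distance [(b - a) / 3] on either
    side of the midpoint of [[a, b]], so averaging contributes one more factor
    [cos (q (b - a) / 3)]. *)
Lemma midpoint_avg_sin (R : realType) (p q : R) (n : nat) (a b : R) :
  midpoint_avg (fun t => sin (p - q * t)) n a b =
  sin (p - q * ((a + b) / 2)) *
    \prod_(1 <= k < n.+1) cos (q * (b - a) / 3 ^+ k).
Proof.
elim: n a b => [|n IH] a b /=; first by rewrite big_nil mulr1.
rewrite !IH [in RHS]big_nat_recl //=.
have E u : u = (b - a) / 3 -> \prod_(1 <= k < n.+1) cos (q * u / 3 ^+ k) =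
    \prod_(1 <= k < n.+1) cos (q * (b - a) / 3 ^+ k.+1).
  move=> ->; apply: eq_bigr => k _; congr cos; rewrite exprS; field.
  by rewrite expf_neq0.
rewrite (E (a + (b - a) / 3 - a)); last by field.
rewrite (E (b - (b - (b - a) / 3))); last by field.
rewrite expr1 -mulrDl [LHS]mulrAC [RHS]mulrA; congr (_ * _).
set m := p - q * ((a + b) / 2); set d := q * (b - a) / 3.
rewrite (_ : p - q * ((a + _) / 2) = m + d); last by rewrite /m /d; field.
rewrite (_ : p - q * ((_ + b) / 2) = m - d); last by rewrite /m /d; field.
by rewrite sinD sinB; field.
Qed.

Section midpoint_rule.
Variables (R : realType) (c : probability (measurableTypeR R) R).
Variables (f : measurableTypeR R -> R) (K : R).
Hypothesis mf : measurable_fun [set: measurableTypeR R] f.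
Hypothesis fK : forall u v : R, `|f u - f v| <= K * `|u - v|.

Lemma lipschitz_const_ge0 : 0 <= K.
Proof. by have := fK 1 0; rewrite subr0 normr1 mulr1; apply: le_trans. Qed.

Lemma lipschitz_integrable (a b : R) : a <= b ->
  c.-integrable `[a, b]%classic (EFin \o f).
Proof.
move=> ab; have K0 := lipschitz_const_ge0.
apply: (@bounded_integrable _ _ _ _ _ _ (`|f a| + K * (b - a))) => //.
move=> t; rewrite /= in_itv /= => tab; rewrite -[f t](subrK (f a)) addrC.
apply: le_trans (ler_normD _ _) _; rewrite lerD2l.
apply: le_trans (fK _ _) _; rewrite ler_wpM2l // ger0_norm; lra.
Qed.

Lemma Rintegral_split_gap (a b s : R) : a < b -> cantor_on c a b s ->
  \int[c]_(t in `[a, b]) f t =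
  \int[c]_(t in `[a, a + (b - a) / 3]) f t +
  \int[c]_(t in `[b - (b - a) / 3, b]) f t.
Proof.
move=> ab H; rewrite -Rintegral_setU //=.
- rewrite /Rintegral (negligible_integral _ _ _ (cantor_on_gap ab H)) //=.
    congr (fine (integral _ _ _)).
    apply/seteqP; split => u /=; rewrite !in_itv /=.
      move=> [uab nu]; have [?|?] := leP u (a + (b - a) / 3); [left|right]; first lra.
      by apply/andP; split; [rewrite leNgt; apply/negP => ?; apply: nu|]; lra.
    by case=> ?; split; try lra; apply/negP; rewrite negb_and -!leNgt; apply/orP; lra.
  by apply: lipschitz_integrable; lra.
- apply: integrableS (lipschitz_integrable (ltW ab)) => //=.
  + exact: measurableU.
  + by move=> u [] /=; rewrite !in_itv /=; lra.
- apply/disj_setPS => u /= [] /=; rewrite !in_itv /=; lra.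
Qed.

(** A function with Lipschitz constant [K] differs from its midpoint value by at
    most [K] times the length of the interval, and the intervals shrink by a
    factor of 3 at each stage. *)
Lemma midpoint_rule (n : nat) (a b s : R) : a < b -> cantor_on c a b s ->
  `|\int[c]_(t in `[a, b]) f t - s * midpoint_avg f n a b| <=
  s * (K * ((b - a) / 3 ^+ n)).
Proof.
elim: n a b s => [|n IH] a b s ab H.
  rewrite expr0 divr1 /=; set m := (a + b) / 2.
  have cs : fine (c `[a, b]%classic) = s by rewrite (cantor_onW H).
  rewrite -{1}cs [fine _ * _]mulrC -Rintegral_cst //= -RintegralB //=; last 2 first.
  - by apply: lipschitz_integrable; lra.
  - exact: finite_measure_integrable_cst.
  have mg : measurable_fun [set: measurableTypeR R] (fun t => f t - f m).
    exact: measurable_funB.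
  have gB t : t \in `[a, b] -> `|f t - f m| <= K * (b - a).
    rewrite in_itv /= => tab; apply: le_trans (fK _ _) _.
    by rewrite ler_wpM2l ?lipschitz_const_ge0 // ler_norml /m; lra.
  apply: le_trans (le_normr_Rintegral _ _) _ => //=.
    exact: (@bounded_integrable _ _ _ _ _ _ (K * (b - a))).
  rewrite [leRHS]mulrC -cs -Rintegral_cst //; apply: le_Rintegral => //=.
  - apply: (@bounded_integrable _ _ _ _ _ (fun t => `|f t - f m|) (K * (b - a))) => //.
      exact: measurableT_comp.
    by move=> t tab; rewrite normr_id; exact: gB.
  - exact: finite_measure_integrable_cst.
rewrite (Rintegral_split_gap ab H) /=.
have := IH _ _ _ _ (cantor_on_left H).
have := IH _ _ _ _ (cantor_on_right H).
have := cantor_on_ge0 H.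
set I2 := Rintegral _ _ _; set I1 := Rintegral _ _ _.
set V2 := midpoint_avg _ _ _ _; set V1 := midpoint_avg _ _ _ _.
move=> s0 /(_ ltac:(lra)) H2 /(_ ltac:(lra)) H1.
rewrite (_ : I1 + I2 - _ = (I1 - s / 2 * V1) + (I2 - s / 2 * V2)); last by field.
apply: le_trans (ler_normD _ _) _; apply: le_trans (lerD H1 H2) _.
rewrite le_eqVlt; apply/orP; left; apply/eqP; rewrite exprS; field.
by rewrite expf_neq0.
Qed.

Lemma midpoint_avg_cvg (a b : R) : a < b -> cantor_on c a b 1 ->
  midpoint_avg f n a b @[n --> \oo] --> \int[c]_(t in `[a, b]) f t.
Proof.
move=> ab H.
have e0 : K * (b - a) * (1 / 3) ^+ n @[n --> \oo] --> (0 : R).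
  rewrite -(mulr0 (K * (b - a))); apply: cvgMl_tmp; apply: cvg_expr.
  by rewrite ger0_norm; lra.
apply/cvgrPdist_le => e e_gt0; move/cvgrPdist_le : e0 => /(_ _ e_gt0).
apply: filterS => n; rewrite sub0r normrN => /(le_trans (ler_norm _)).
apply: le_trans; have := midpoint_rule n ab H; rewrite !mul1r => /le_trans; apply.
by rewrite exprVn mulrA.
Qed.
End midpoint_rule.

(** * Fourier coefficients of the Cantor measure *)

Lemma dist_sin_le (R : realType) (u v : R) : `|sin u - sin v| <= `|u - v|.
Proof.
wlog uv : u v / u <= v.
  by move=> H; case/orP: (le_total u v) => ?; [|rewrite distrC [leRHS]distrC]; exact: H.
rewrite distrC [leRHS]distrC.
have sin_cont : {within `[u, v], continuous (@sin R)}.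
  by apply: continuous_subspaceT => w; exact: continuous_sin.
have [z _ ->] := MVT_segment uv (fun w _ => is_derive_sin w) sin_cont.
by rewrite normrM ler_piMl // cos_max.
Qed.

Lemma bounded_convergence (d : measure_display) (T : measurableType d)
    (R : realType) (mu : probability T R) (D Z : set T) (f_ : nat -> T -> R)
    (f : T -> R) (B : R) :
  measurable D -> measurable Z -> mu Z = 0%E ->
  (forall n, measurable_fun [set: T] (f_ n)) -> measurable_fun [set: T] f ->
  (forall n t, D t -> `|f_ n t| <= B) ->
  (forall t, D t -> ~ Z t -> f_ n t @[n --> \oo] --> f t) ->
  \int[mu]_(t in D) f_ n t @[n --> \oo] --> \int[mu]_(t in D) f t.
Proof.
move=> mD mZ Z0 mf_ mf fB fcvg.
have [|||||fi _ H] := @dominated_convergence _ _ _ mu D mD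
  (fun n t => (f_ n t)%:E) (EFin \o f) (EFin \o cst B).
- by move=> n; apply/measurable_EFinP; exact: measurable_funTS.
- by apply/measurable_EFinP; exact: measurable_funTS.
- exists Z; split => // t /= nt; apply: contrapT => Zt; apply: nt => Dt.
  by apply: cvg_EFin; [exact: nearW|exact: fcvg].
- exact: finite_measure_integrable_cst.
- by apply: aeW => t n Dt; rewrite /= lee_fin fB.
apply: fine_cvg; rewrite fineK //; exact: integrable_fin_num.
Qed.

Section cantor_measure.
Variables (R : realType) (c : probability (measurableTypeR R) R).
Hypothesis hc : is_cantor_measure c.

Lemma is_cantor_measure_on : cantor_on c 0 1 1.
Proof. by move=> w; rewrite hc; congr EFin; rewrite [RHS]mul1r. Qed.

Lemma measurable_sin_affine (p q : R) :
  measurable_fun [set: measurableTypeR R] (fun t : R => sin (p - q * t)).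
Proof.
apply: continuous_measurable_fun => t.
apply: continuous_comp; last exact: continuous_sin.
by apply: cvgB; [exact: cvg_cst|apply: cvgMl_tmp; exact: cvg_id].
Qed.

Lemma cantor_integral_id : \int[c]_(t in `[0, 1]) t = 1 / 2.
Proof.
have := @midpoint_avg_cvg R c id 1 (@measurable_id _ _ _) _ _ _ ltr01.
move=> /(_ (fun u v => ltac:(by rewrite mul1r)) is_cantor_measure_on).
under eq_cvg do rewrite midpoint_avg_id.
move=> /(cvg_lim (@Rhausdorff R)) <-; rewrite lim_cst //; lra.
Qed.

Lemma cantor_integral_sin (p q : R) :
  sin (p - q / 2) * \prod_(1 <= k < n.+1) cos (q / 3 ^+ k) @[n --> \oo] -->
  \int[c]_(t in `[0, 1]) sin (p - q * t).
Proof.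
have L u v : `|sin (p - q * u) - sin (p - q * v)| <= `|q| * `|u - v|.
  apply: le_trans (dist_sin_le _ _) _; rewrite -normrM distrC.
  by rewrite le_eqVlt; apply/orP; left; apply/eqP; congr `|_|; ring.
have := midpoint_avg_cvg (measurable_sin_affine p q) L ltr01 is_cantor_measure_on.
under eq_cvg do rewrite midpoint_avg_sin subr0 mulr1 add0r mul1r.
by [].
Qed.

(** The phase is chosen so that the wave equals 1 at the midpoint [1 / 2]. *)
Lemma cos_partial_prod_cvg (n : nat) : cvgn (@cos_partial_prod R n).
Proof.
have := @cantor_integral_sin (n%:R * pi + pi / 2) (2 * n%:R * pi).
rewrite (_ : _ - _ = pi / 2); last by field.
by rewrite sin_pihalf; under eq_cvg do rewrite mul1r; move/cvgP.
Qed.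

Lemma cantor_fourier (n : nat) (x : R) :
  \int[c]_(t in `[0, 1]) sin (2 * n%:R * (pi * (x - t))) =
  (-1) ^+ n * cos_infinite_prod R n * sin (2 * pi * n%:R * x).
Proof.
have := @cantor_integral_sin (2 * pi * n%:R * x) (2 * n%:R * pi).
set I := Rintegral _ _ _ => cvgI.
rewrite (_ : Rintegral _ _ _ = I); last first.
  by apply: eq_Rintegral => t _; congr sin; ring.
rewrite -(cvg_lim (@Rhausdorff R) cvgI).
have -> : sin (2 * pi * n%:R * x - 2 * n%:R * pi / 2) =
    (-1) ^+ n * sin (2 * pi * n%:R * x).
  (* The phase [n pi] at the midpoint produces the sign [(-1) ^+ n]. *)
  set y := 2 * pi * _ * x.
  have := alternatingn (@sinDpi R) n (y - n%:R * pi).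
  rewrite -[pi *+ n]mulr_natl subrK => ->; rewrite mulrA -expr2 sqrr_sign mul1r.
  by congr sin; field.
rewrite [RHS]mulrAC; apply/cvg_lim => //.
by apply: cvgMl_tmp; exact: cos_partial_prod_cvg.
Qed.

(** * The distribution function *)

Lemma measurable_sawtooth_sum (N : nat) (x : R) :
  measurable_fun [set: measurableTypeR R] (fun t : R => sawtooth_sum N (pi * (x - t))).
Proof.
elim: N => [|N IH].
  rewrite (_ : (fun _ => _) = cst 0); first exact: measurable_cst.
  by apply/funext => t; rewrite /sawtooth_sum big_nil.
under eq_fun do rewrite sawtooth_sumS.
apply: measurable_funD => //; apply: measurable_funM; last exact: measurable_cst.
rewrite (_ : (fun _ => _) =
  fun t => sin (2 * N.+1%:R * pi * x - 2 * N.+1%:R * pi * t)).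
  exact: measurable_sin_affine.
by apply/funext => t; congr sin; ring.
Qed.

(** In each term, the factor [(-1) ^+ n * cos_infinite_prod R n] comes from the
    integral and the [- 1] from the sawtooth at [pi * x]. *)
Lemma sine_partial_sumE (x : R) (N : nat) : sine_partial_sum x N =
  \int[c]_(t in `[0, 1]) sawtooth_sum N (pi * (x - t)) - sawtooth_sum N (pi * x).
Proof.
have sint (p q : R) : c.-integrable `[0, 1]%classic (EFin \o (fun t => sin (p - q * t))).
  apply: (@bounded_integrable _ _ _ _ _ _ 1) => //.
    exact: measurable_sin_affine.
  by move=> t _; exact: sin_max.
suff : \int[c]_(t in `[0, 1]) sawtooth_sum N (pi * (x - t)) =
    \sum_(1 <= n < N.+1)
      (-1) ^+ n * cos_infinite_prod R n / n%:R * sin (2 * pi * n%:R * x).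
  move=> ->; rewrite /sine_partial_sum /sawtooth_sum -sumrB; apply: eq_bigr => n _.
  rewrite (_ : 2 * n%:R * (pi * x) = 2 * pi * n%:R * x); last by ring.
  by rewrite [in LHS]mulrBl mulrBl mul1r [_^-1 * _]mulrC.
have intS n : c.-integrable `[0, 1]%classic
    (EFin \o (fun t => sin (2 * n%:R * (pi * (x - t))))).
  rewrite (_ : (fun _ => _) =
    fun t => sin (2 * n%:R * pi * x - 2 * n%:R * pi * t)); first exact: sint.
  by apply/funext => t; congr sin; ring.
elim: N => [|N IH].
  rewrite big_nil (_ : Rintegral _ _ _ = \int[c]_(t in `[0, 1]) 0).
    by rewrite Rintegral_cst //= mul0r.
  by apply: eq_Rintegral => t _; rewrite /sawtooth_sum big_nil.
rewrite big_nat_recr //= -IH.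
have -> : \int[c]_(t in `[0, 1]) sawtooth_sum N.+1 (pi * (x - t)) =
    \int[c]_(t in `[0, 1]) (sawtooth_sum N (pi * (x - t)) +
      sin (2 * N.+1%:R * (pi * (x - t))) / N.+1%:R).
  by apply: eq_Rintegral => t _; rewrite sawtooth_sumS.
have -> : (-1) ^+ N.+1 * cos_infinite_prod R N.+1 / N.+1%:R *
      sin (2 * pi * N.+1%:R * x) =
    \int[c]_(t in `[0, 1]) (sin (2 * N.+1%:R * (pi * (x - t))) / N.+1%:R).
  by rewrite RintegralZr //= cantor_fourier mulrAC.
rewrite -RintegralD //=.
  apply: (@bounded_integrable _ _ _ _ _ _ (\sum_(1 <= n < N.+1) 1)) => //.
    exact: measurable_sawtooth_sum.
  move=> t _; apply: le_trans (ler_norm_sum _ _ _) _.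
  rewrite big_nat [leRHS]big_nat; apply: ler_sum => n /andP[n0 _].
  rewrite normrM normfV [`|n%:R|]ger0_norm // ler_pdivrMr ?ltr0n // mul1r.
  by apply: le_trans (sin_max _) _; rewrite ler1n.
rewrite (_ : _ \o _ = fun t => (N.+1%:R^-1)%:E *
    (EFin \o (fun t => sin (2 * N.+1%:R * (pi * (x - t))))) t)%E.
  exact: integrableZl.
by apply/funext => t; rewrite /= -EFinM mulrC.
Qed.

(** The pointwise limit [g] of the integrands jumps at [t = x]; the partial sums
    vanish there, but the point [x] has measure zero. *)
Lemma cantor_sawtooth_cvg (x : R) : 0 < x < 1 ->
  \int[c]_(t in `[0, 1]) sawtooth_sum N (pi * (x - t)) @[N --> \oo] -->
  pi * (distribution_function c x - x).
Proof.
move=> x01; have pi0 := @pi_gt0 R.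
pose g (t : R) :=
  pi * (\1_(`[0, x[%classic : set (measurableTypeR R)) t + (t - (x + 1 / 2))).
have mind : measurable_fun [set: measurableTypeR R]
    (\1_(`[0, x[%classic : set (measurableTypeR R)) : _ -> R).
  exact: measurable_indic.
have ind_int : c.-integrable `[0, 1]%classic
    (EFin \o \1_(`[0, x[%classic : set (measurableTypeR R))).
  apply: (@bounded_integrable _ _ _ _ _ _ 1) => // t _.
  by rewrite indicE ger0_norm // lern1 leq_b1.
have aff_int : c.-integrable `[0, 1]%classic (EFin \o (fun t : R => t - (x + 1 / 2))).
  apply: (@bounded_integrable _ _ _ _ _ _ 2) => //.
    by apply: measurable_funB => //; exact: measurable_cst.
  by move=> t; rewrite /= in_itv /= ler_norml => ?; lra.
have -> : pi * (distribution_function c x - x) = \int[c]_(t in `[0, 1]) g t.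
  rewrite RintegralZl //=; last first.
    exact: (integrableD _ ind_int aff_int).
  rewrite RintegralD // RintegralB //=; last 2 first.
  - apply: (@bounded_integrable _ _ _ _ _ _ 1) => // t.
    by rewrite /= in_itv /= ler_norml; lra.
  - exact: finite_measure_integrable_cst.
  rewrite cantor_integral_id Rintegral_cst //= (cantor_onW is_cantor_measure_on).
  rewrite /= mulr1.
  rewrite /Rintegral integral_indic //= setIidl.
    by rewrite /distribution_function; congr (_ * _); lra.
  by move=> t /=; rewrite !in_itv /=; lra.
apply: (@bounded_convergence _ _ _ c _ [set x] _ _ (2 + pi)) => //.
- apply: (cantor_on_set1 ltr01 _ is_cantor_measure_on).
  by rewrite in_itv /=; lra.
- by move=> N; exact: measurable_sawtooth_sum.
- apply: measurable_funM => //; apply: measurable_funD => //.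
  by apply: measurable_funB => //; exact: measurable_cst.
- move=> N t; rewrite /= in_itv /= => t01; apply: sawtooth_sum_bounded; nra.
move=> t; rewrite /= in_itv /= => t01 /eqP tx; rewrite /g indicE.
have [t_lt_x|x_le_t] := ltP t x.
  rewrite mem_set /=; last by rewrite /= in_itv /=; lra.
  rewrite [X in _ --> X](_ : _ = pi / 2 - pi * (x - t)); last by field.
  by apply: sawtooth_sum_cvg; nra.
rewrite memNset /=; last by rewrite /= in_itv /=; lra.
rewrite [X in _ --> X](_ : _ = - (pi / 2 - pi * (t - x))); last by field.
under eq_cvg do rewrite -opprB mulrN sawtooth_sumN.
apply: cvgN; apply: sawtooth_sum_cvg.
by have xt : x < t by [rewrite lt_neqAle eq_sym tx]; nra.
Qed.
End cantor_measure.

Theorem mainTheorem2 (R : realType) (c : probability (measurableTypeR R) R)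
    (hc : is_cantor_measure c) (x : R) (hx : 0 < x < 1) :
  [/\ forall n : nat, (0 < n)%N -> cvgn (@cos_partial_prod R n),
      cvgn (sine_partial_sum x)
    & distribution_function c x =
        1 / 2 + 1 / pi * limn (sine_partial_sum x)].
Proof.
have pi0 := @pi_gt0 R.
have S_cvg : sine_partial_sum x N @[N --> \oo] -->
    pi * (distribution_function c x - 1 / 2).
  under eq_cvg do rewrite (sine_partial_sumE hc).
  rewrite (_ : pi * _ = pi * (distribution_function c x - x) - (pi / 2 - pi * x)).
    apply: cvgB; first exact: cantor_sawtooth_cvg.
    by apply: sawtooth_sum_cvg; nra.
  by field.
split; first by move=> n _; exact: (cos_partial_prod_cvg hc).
  exact: (cvgP _ S_cvg).
rewrite (cvg_lim (@Rhausdorff R) S_cvg) [1 / pi]div1r mulKf; first by lra.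
by rewrite gt_eqF.
Qed.
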